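(* Let $d, n \in \mathbb{N}$ with $n \ge 1$, let $\{\chi_{\bm{s}} : \bm{s} \in \mathbb{R}^d\}$ be an isotropic functional random field with values in $\mathcal{H} = L^2([0,1])$, with covariance kernels $\sigma_h(\cdot,\cdot)$, $h \ge 0$, and trace-covariogram $\sigma_{\mathrm{tr}}(h) = \int_0^1 \sigma_h(t,t)\,dt$, where $\sigma_{\mathrm{tr}}(0) > 0$. Consider a sample $\chi_{\bm{s}_1}, \dots, \chi_{\bm{s}_n}$ of this field at locations $\bm{s}_1, \dots, \bm{s}_n \in \mathbb{R}^d$, and let $$\mathrm{ESS}_{\mathcal{F}} = n^2\, \sigma_{\mathrm{tr}}(0) \left( \sum_{i=1}^n \sum_{j=1}^n \sigma_{\mathrm{tr}}(\|\bm{s}_i - \bm{s}_j\|) \right)^{-1}$$ be the functional effective sample size. Then: (1) If $\sigma_{\|\bm{s}_i - \bm{s}_j\|}(t,t) = 0$ for all $t \in [0,1]$ and all $i \ne j$, then $\mathrm{ESS}_{\mathcal{F}} = n$. (2) If $\sigma_{\|\bm{s}_i - \bm{s}_j\|}(t,t) = \sigma_0(t,t)$ for all $t \in [0,1]$ and all $i,j = 1,\dots,n$, then $\mathrm{ESS}_{\mathcal{F}} = 1$.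
   Context: Let $\mathcal{H} = L^2([0,1])$ be the real Hilbert space with inner product $\langle f, g\rangle = \int_0^1 f(t) g(t)\,dt$ and norm $\|f\|_{\mathcal{H}} = \langle f,f\rangle^{1/2}$; $\|\cdot\|$ denotes the Euclidean norm on $\mathbb{R}^d$. A functional random field on $\mathbb{R}^d$ is a collection $\{\chi_{\bm{s}} : \bm{s} \in \mathbb{R}^d\}$ of $\mathcal{H}$-valued random variables. When $E[\|\chi_{\bm{s}}\|_{\mathcal{H}}] < \infty$, the mean function $\mu_{\bm{s}} \in \mathcal{H}$ is defined by $E[\langle \chi_{\bm{s}}, f\rangle] = \langle \mu_{\bm{s}}, f\rangle$ for all $f \in \mathcal{H}$. When $E[\|\chi_{\bm{s}}\|_{\mathcal{H}}^2] < \infty$ for all $\bm{s}$, the covariance operators are $C_{\bm{s}_1,\bm{s}_2}(f) = E[\langle \chi_{\bm{s}_1} - \mu_{\bm{s}_1}, f\rangle (\chi_{\bm{s}_2} - \mu_{\bm{s}_2})]$, $f \in \mathcal{H}$. The field is weakly stationary if $E[\|\chi_{\bm{s}}\|_{\mathcal{H}}^2] < \infty$ for all $\bm{s}$, $\mu_{\bm{s}} = \mu$ does not depend on $\bm{s}$, and $C_{\bm{s}_1,\bm{s}_2}$ depends on $\bm{s}_1,\bm{s}_2$ only through $\bm{s}_1 - \bm{s}_2$; it is isotropic if it is weakly stationary and $C_{\bm{s}_1,\bm{s}_2}$ depends on $\bm{s}_1,\bm{s}_2$ only through $\|\bm{s}_1 - \bm{s}_2\|$. The operator $C_{\bm{s}_1,\bm{s}_2}$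 has kernel $\sigma_{\bm{s}_1,\bm{s}_2}(t,u) = \mathrm{cov}[\chi_{\bm{s}_1}(t), \chi_{\bm{s}_2}(u)]$, $t,u\in[0,1]$; under isotropy it depends on the locations only through $h = \|\bm{s}_1 - \bm{s}_2\|$ and is written $\sigma_h(t,u)$. The trace-covariogram is $$\sigma_{\mathrm{tr}}(\bm{s}_1,\bm{s}_2) = E[\langle \chi_{\bm{s}_1} - \mu_{\bm{s}_1}, \chi_{\bm{s}_2} - \mu_{\bm{s}_2}\rangle] = \int_0^1 \sigma_{\bm{s}_1,\bm{s}_2}(t,t)\,dt,$$ which under isotropy depends only on $h = \|\bm{s}_1 - \bm{s}_2\|$ and is written $\sigma_{\mathrm{tr}}(h) = \int_0^1 \sigma_h(t,t)\,dt$. *)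

(* Defs.v *)
From HB Require Import structures.
From mathcomp Require Import all_boot all_order all_algebra.
From mathcomp Require Import all_classical all_reals all_analysis.

Set Implicit Arguments.
Unset Strict Implicit.
Unset Printing Implicit Defensive.

Import Order.TTheory GRing.Theory Num.Theory.
Import numFieldNormedType.Exports.

Local Open Scope classical_set_scope.
Local Open Scope ring_scope.

(* The library norm on 'rV[R]_d is the sup norm, hence this definition. *)
Definition enorm (R : realType) (d : nat) (x : 'rV[R]_d) : R :=
  Num.sqrt (\sum_(k < d) x ord0 k ^+ 2).

Lemma lebesgue_01_lty (R : realType) :
  (lebesgue_measure (`[0%R, 1%R]%classic : set (measurableTypeR R)) < +oo)%E.
Proof. by rewrite lebesgue_measure_itv/= lte01 oppr0 adde0 ltry. Qed.

(* Lebesgue measure of the intersection with [0,1]: functions on [0,1] are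
   represented by functions on R, whose values off [0,1] do not matter. *)
Definition leb01 (R : realType) :
    {finite_measure set (measurableTypeR R) -> \bar R} :=
  mfrestr (measurable_itv `[0, 1] : measurable (_ : set (measurableTypeR R)))
    (lebesgue_01_lty R).

(* Elements of the Hilbert space L^2([0,1]) are represented by members of
   [Lfun (leb01 R) 2%:E], and equality in that space is equality
   [leb01 R]-almost everywhere. *)
Definition inner (R : realType) (f g : R -> R) : R :=
  Rintegral (leb01 R) setT (fun t => f t * g t).

Definition hnorm (R : realType) (f : R -> R) : R := Num.sqrt (inner f f).

Section L2_random_variables.
Context (R : realType) (dO : measure_display) (Omega : measurableType dO).
Variable P : probability Omega R.
Implicit Types X Y : Omega -> R -> R.

(* A random variable with values in L^2([0,1]) is given by a jointly measurable
   representative; one always exists as L^2([0,1]) is separable, and without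
   one the covariances of the values at t and u would be meaningless. *)
Definition L2_rv X : Prop :=
  measurable_fun [set: Omega * R] (fun p : Omega * R => X p.1 p.2) /\
  forall w, X w \in Lfun (leb01 R) 2%:E.

Definition is_Hmean X (m : R -> R) : Prop :=
  m \in Lfun (leb01 R) 2%:E /\
  forall f, f \in Lfun (leb01 R) 2%:E ->
    ('E_P[fun w => inner (X w) f] = (inner m f)%:E)%E.

(* A representative of the expectation in L^2([0,1]), which is unique up to
   almost everywhere equality and exists as soon as [hnorm \o X] is
   integrable. *)
Definition Hmean X : R -> R := xget (cst 0) [set m | is_Hmean X m].

Definition Hcentered X : Omega -> R -> R := fun w t => X w t - Hmean X t.

Definition cov_op X Y (f : R -> R) : R -> R :=
  Hmean (fun w t => inner (Hcentered X w) f * Hcentered Y w t).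

Definition trace_cov X Y : R :=
  fine ('E_P[fun w => inner (Hcentered X w) (Hcentered Y w)])%E.

Definition cov_kernel X Y (t u : R) : \bar R :=
  covariance P (fun w => X w t) (fun w => Y w u).

End L2_random_variables.

Section functional_random_fields.
Context (R : realType) (dO : measure_display) (Omega : measurableType dO).
Variables (P : probability Omega R) (d : nat).
Implicit Type chi : 'rV[R]_d -> Omega -> R -> R.

Definition functional_random_field chi : Prop := forall s, L2_rv (chi s).

Definition weakly_stationary chi : Prop :=
  [/\ forall s, ('E_P[fun w => (hnorm (chi s w) ^+ 2)%R] < +oo)%E,
      forall s s', Hmean P (chi s) = Hmean P (chi s') %[ae leb01 R] &
      forall s1 s2 s1' s2', s1 - s2 = s1' - s2' ->
        forall f, f \in Lfun (leb01 R) 2%:E ->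
          cov_op P (chi s1) (chi s2) f = cov_op P (chi s1') (chi s2') f
            %[ae leb01 R]].

Definition isotropic chi : Prop :=
  weakly_stationary chi /\
  forall s1 s2 s1' s2', enorm (s1 - s2) = enorm (s1' - s2') ->
    forall f, f \in Lfun (leb01 R) 2%:E ->
      cov_op P (chi s1) (chi s2) f = cov_op P (chi s1') (chi s2') f
        %[ae leb01 R].

(* [sigma h t u] is the covariance kernel of [chi] at distance h. A kernel is
   determined by its operator only almost everywhere, whence the "almost
   every"; the diagonal, a null set of the square, needs a separate clause. *)
Definition isotropic_kernel chi (sigma : R -> R -> R -> R) : Prop :=
  forall s1 s2,
    {ae (leb01 R \x leb01 R)%E, forall z : R * R,
       cov_kernel P (chi s1) (chi s2) z.1 z.2 =
       (sigma (enorm (s1 - s2)) z.1 z.2)%:E} /\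
    {ae leb01 R, forall t,
       cov_kernel P (chi s1) (chi s2) t t = (sigma (enorm (s1 - s2)) t t)%:E}.

(* The common value of [trace_cov P (chi s1) (chi s2)] over all s1, s2 at
   distance h. *)
Definition trace_covariogram chi (h : R) : R :=
  xget 0 [set c | exists s1 s2,
    enorm (s1 - s2) = h /\ c = trace_cov P (chi s1) (chi s2)].

Definition ESS_F chi (n : nat) (s : 'I_n -> 'rV[R]_d) : R :=
  n%:R ^+ 2 * trace_covariogram chi 0 *
  (\sum_(i < n) \sum_(j < n) trace_covariogram chi (enorm (s i - s j)))^-1.

End functional_random_fields.

(* Main.v *)
Require Import Defs.
From mathcomp Require Import all_boot all_order all_algebra.
From mathcomp Require Import all_classical all_reals all_analysis.
From mathcomp Require Import measurable_realfun.

Import Order.TTheory GRing.Theory Num.Theory.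
Import numFieldNormedType.Exports.

Local Open Scope classical_set_scope.
Local Open Scope ring_scope.

(** Fubini's theorem on Omega x [0,1] gives the formula
    [trace_cov X Y = \int_0^1 cov(X(t), Y(t)) dt]. Its one delicate point is that
    the mean of X in L^2([0,1]) must agree almost everywhere with the pointwise
    mean t |-> E[X(t)]: the latter is square integrable because
    E[X(t)]^2 <= E[X(t)^2], and Fubini shows that it satisfies the weak
    definition of the mean. Hence the trace-covariogram at distance h is the
    integral of the diagonal of sigma_h, and both claims reduce to evaluating the
    double sum. *)

(** * Square-integrable functions, first on one space, then on a product *)

Lemma sqr_integral_Lfun2 {R : realType} {d} {T : measurableType d}
    (mu : {measure set T -> \bar R}) (f : T -> R) :
  measurable_fun setT f -> (\int[mu]_x (f x ^+ 2)%:E < +oo)%E ->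
  f \in Lfun mu 2%:E.
Proof.
move=> mf f2; rewrite inE; apply/andP; split; rewrite inE//=.
rewrite /finite_norm unlock; apply: poweR_lty.
apply: le_lt_trans f2; under [leLHS]eq_integral => x _.
  rewrite poweR_EFin powR_mulrn// real_normK ?num_real//; over.
by [].
Qed.

Lemma Lfun_measurable {R : realType} {d} {T : measurableType d}
    {mu : {measure set T -> \bar R}} {p} {f : T -> R} :
  f \in Lfun mu p -> measurable_fun setT f.
Proof. by rewrite inE => /andP[/[!inE]]. Qed.

Lemma Lfun2B {R : realType} {d} {T : measurableType d}
    {mu : {measure set T -> \bar R}} {f g : T -> R} :
  f \in Lfun mu 2%:E -> g \in Lfun mu 2%:E -> f \- g \in Lfun mu 2%:E.
Proof. by move=> f2 g2; rewrite rpredB ?lee1n. Qed.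

Section product_L2.
Context {R : realType} {d1 d2} {T1 : measurableType d1} {T2 : measurableType d2}.
Context {P : probability T1 R} {mu : {finite_measure set T2 -> \bar R}}.

Lemma Lfun2_snd {f : T2 -> R} :
  f \in Lfun mu 2%:E -> (f \o snd) \in Lfun (P \x mu)%E 2%:E.
Proof.
move=> f2; have mf := Lfun_measurable f2.
have mfs : measurable_fun setT (f \o @snd T1 T2) by exact: measurableT_comp.
apply: sqr_integral_Lfun2 => //.
rewrite fubini_tonelli1//=; last by move=> x; rewrite lee_fin sqr_ge0.
  rewrite /fubini_F/= (integral_cst P) //= probability_setT mule1.
  by have /Lfun2_integrable_sqr/integrableP[_] := f2;
     under eq_integral do rewrite /= ger0_norm ?sqr_ge0//.
by apply/measurable_EFinP; exact: measurable_funX.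
Qed.

(** Hölder's inequality against the constant 1, which is square integrable because both measures are
    finite. *)
Lemma Lfun2_prod_integrable {g : T1 * T2 -> R} :
  g \in Lfun (P \x mu)%E 2%:E -> (P \x mu)%E.-integrable setT (EFin \o g).
Proof.
move=> g2; apply/(Lfun1_integrable (P \x mu)%E).
have c2 : (cst 1 \o snd : T1 * T2 -> R) \in Lfun (P \x mu)%E 2%:E.
  exact: Lfun2_snd (Lfun_cst mu 1 2).
have := Lfun2_mul_Lfun1 g2 c2.
by rewrite (_ : _ \* _ = g)//; apply/funext => x /=; rewrite mulr1.
Qed.

Lemma Lfun2_marginal_mean {g : T1 * T2 -> R} :
  g \in Lfun (P \x mu)%E 2%:E ->
  (fun t => fine 'E_P[fun w => g (w, t)]) \in Lfun mu 2%:E.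
Proof.
move=> g2; have mg := Lfun_measurable g2.
have mm : measurable_fun setT (fun t => fine 'E_P[fun w => g (w, t)]).
  rewrite unlock; apply: measurableT_comp => //.
  exact: (measurable_fubini_G (Lfun2_prod_integrable g2)).
apply: sqr_integral_Lfun2 => //.
have mg2 : measurable_fun setT (fun x : T1 * T2 => (g x ^+ 2)%:E).
  by apply/measurable_EFinP; exact: measurable_funX.
have g20 : forall x, (0 <= (g x ^+ 2)%:E)%E by move=> x; rewrite lee_fin sqr_ge0.
apply: (@le_lt_trans _ _ (\int[mu]_t \int[P]_w (g (w, t) ^+ 2)%:E)%E).
  apply: ge0_le_integral => //.
  - by move=> t _; rewrite lee_fin sqr_ge0.
  - by apply/measurable_EFinP; exact: measurable_funX.
  - exact: (measurable_fun_fubini_tonelli_G (fun x => (g x ^+ 2)%:E)).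
  (* Where the second moment at [t] is infinite the bound is trivial. *)
  move=> t _; have [gt|] := ltP (\int[P]_w (g (w, t) ^+ 2)%:E)%E +oo%E; last first.
    by rewrite leye_eq => /eqP ->; rewrite leey.
  have gt2 : (fun w => g (w, t)) \in Lfun P 2%:E.
    by apply: sqr_integral_Lfun2 => //; exact: measurableT_comp.
  (* [E[X]^2 <= E[X^2]], by nonnegativity of the variance *)
  have gt1 : 'E_P[fun w => g (w, t)]%E \is a fin_num.
    by rewrite expectation_fin_num// Lfun_subset12 ?fin_num_measure.
  have := variance_ge0 P (fun w => g (w, t)).
  rewrite varianceE// sube_ge0; last by rewrite -(fineK gt1) -EFin_expe.
  rewrite -{1}(fineK gt1) -EFin_expe => /le_trans; apply.
  by rewrite unlock.
have /Lfun2_integrable_sqr/integrableP[_] := g2.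
under eq_integral do rewrite /= ger0_norm ?sqr_ge0//.
by rewrite fubini_tonelli2.
Qed.
End product_L2.

(** * The inner product of L^2([0,1]) *)

Section inner.
Context {R : realType}.
Implicit Types f g : R -> R.

Lemma inner_integrable {f g} :
  f \in Lfun (leb01 R) 2%:E -> g \in Lfun (leb01 R) 2%:E ->
  (leb01 R).-integrable setT (fun t => (f t * g t)%:E).
Proof. by move=> f2 g2; have /Lfun1_integrable := Lfun2_mul_Lfun1 f2 g2. Qed.

Lemma EFin_inner {f g} :
  f \in Lfun (leb01 R) 2%:E -> g \in Lfun (leb01 R) 2%:E ->
  (inner f g)%:E = (\int[leb01 R]_t (f t * g t)%:E)%E.
Proof.
move=> f2 g2; rewrite /inner /Rintegral fineK//.
by apply: integrable_fin_num => //; exact: inner_integrable.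
Qed.

(** Testing against [h = f \- g] makes the integral of the squared difference vanish. *)
Lemma inner_eq_ae {f g} :
  f \in Lfun (leb01 R) 2%:E -> g \in Lfun (leb01 R) 2%:E ->
  (forall h, h \in Lfun (leb01 R) 2%:E -> inner f h = inner g h) ->
  f = g %[ae leb01 R].
Proof.
move=> f2 g2 fg.
have fg2 : f \- g \in Lfun (leb01 R) 2%:E by exact: Lfun2B.
have mfg := Lfun_measurable fg2.
have fgE : (\int[leb01 R]_t ((f t - g t) ^+ 2)%:E = 0)%E.
  under eq_integral do rewrite expr2 mulrBl EFinB.
  rewrite integralB//; [|exact: (inner_integrable f2 fg2)
                        |exact: (inner_integrable g2 fg2)].
  by rewrite -(EFin_inner f2 fg2) -(EFin_inner g2 fg2) fg// subee.
have : ae_eq (leb01 R) setT (fun t => ((f t - g t) ^+ 2)%:E) (cst 0%E).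
  apply/ae_eq_integral_abs => //.
    by apply/measurable_EFinP; exact: measurable_funX.
  by under eq_integral do rewrite /= ger0_norm ?sqr_ge0//.
apply: filterS => t /= /(_ I) [] /eqP.
by rewrite sqrf_eq0 subr_eq0 => /eqP.
Qed.

End inner.

(** * Means and covariances of random variables in L^2([0,1]) *)

Section L2_random_variables.
Context {R : realType} {dO} {Omega : measurableType dO}.
Variable P : probability Omega R.
Implicit Types X Y : Omega -> R -> R.

Definition L2_rv2 X : Prop :=
  L2_rv X /\ ('E_P[fun w => (hnorm (X w) ^+ 2)%R] < +oo)%E.

(** By Tonelli, the integral of the square over the product is the second moment of the norm. This
    is what licenses every later use of Fubini. *)
Lemma L2_rv2_joint {X} :
  L2_rv2 X -> (fun p => X p.1 p.2) \in Lfun (P \x leb01 R)%E 2%:E.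
Proof.
move=> [[mX X2] EX].
apply: sqr_integral_Lfun2 => //.
rewrite fubini_tonelli1//=; last by move=> x; rewrite lee_fin sqr_ge0.
  apply: le_lt_trans EX; rewrite unlock le_eqVlt; apply/orP; left; apply/eqP.
  apply: eq_integral => w _; rewrite /hnorm sqr_sqrtr; last first.
    by apply: Rintegral_ge0 => // t _; rewrite -expr2 sqr_ge0.
  by rewrite EFin_inner.
by apply/measurable_EFinP; exact: measurable_funX.
Qed.

Lemma expectation_inner {X Y} :
  (forall w, X w \in Lfun (leb01 R) 2%:E) ->
  (forall w, Y w \in Lfun (leb01 R) 2%:E) ->
  (fun p => X p.1 p.2) \in Lfun (P \x leb01 R)%E 2%:E ->
  (fun p => Y p.1 p.2) \in Lfun (P \x leb01 R)%E 2%:E ->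
  ('E_P[fun w => inner (X w) (Y w)] =
   \int[leb01 R]_t 'E_P[fun w => (X w t * Y w t)%R])%E.
Proof.
move=> X2 Y2 jX jY; rewrite unlock.
under eq_integral do rewrite EFin_inner//.
have /Lfun1_integrable := Lfun2_mul_Lfun1 jX jY.
by move=> /Fubini.
Qed.

(** [covariance] centres by exactly this function; [fine] puts 0 where the mean at [t] is
    infinite. *)
Definition pointwise_mean X : R -> R := fun t => fine 'E_P[X ^~ t].

Lemma pointwise_mean_Hmean {X} :
  L2_rv2 X -> is_Hmean P X (pointwise_mean X).
Proof.
move=> X2; have jX := L2_rv2_joint X2; have mX2 := Lfun2_marginal_mean jX.
split=> // f f2; rewrite (@expectation_inner X (fun=> f))//; first last.
- exact: Lfun2_snd.
- by case: X2 => -[].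
rewrite EFin_inner//.
apply: ae_eq_integral => //.
- rewrite unlock.
  have /Lfun1_integrable := Lfun2_mul_Lfun1 jX (Lfun2_snd f2).
  exact: measurable_fubini_G.
- apply/measurable_EFinP.
  exact: measurable_funM (Lfun_measurable mX2) (Lfun_measurable f2).
(* For almost every [t] the variable [X ^~ t] is integrable, so [f t] factors out of the expectation
   and [fine] loses nothing. *)
have := ae_integrable2 (Lfun2_prod_integrable jX).
apply: filterS => t /= Xt _; rewrite unlock.
under eq_integral do rewrite EFinM.
by rewrite integralZr// EFinM /pointwise_mean unlock fineK// integrable_fin_num.
Qed.

(** The pointwise mean is a witness, so [xget] does not fall back on its default. *)
Lemma HmeanP {X} : L2_rv2 X -> is_Hmean P X (Hmean P X).
Proof.
by move=> X2; apply: (@xgetPex _ _ [set m | is_Hmean P X m]);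
  exists (pointwise_mean X); exact: pointwise_mean_Hmean.
Qed.

Lemma Hmean_ae {X} :
  L2_rv2 X -> Hmean P X = pointwise_mean X %[ae leb01 R].
Proof.
move=> X2; have [h2 hE] := HmeanP X2.
have [m2 mE] := pointwise_mean_Hmean X2.
by apply: inner_eq_ae => // f f2; apply/EFin_inj; rewrite -hE// -mE.
Qed.

(** The centring [m] is left free to serve both for [Hmean] and for the pointwise mean. *)
Lemma centered_joint {X m} : L2_rv2 X -> m \in Lfun (leb01 R) 2%:E ->
  (fun p => X p.1 p.2 - m p.2) \in Lfun (P \x leb01 R)%E 2%:E.
Proof.
move=> X2 m2.
exact: Lfun2B (L2_rv2_joint X2) (Lfun2_snd m2).
Qed.

(** The diagonal is a marginal integral of a product of two square-integrable functions, so Fubini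
    applies. *)
Lemma measurable_cov_kernel_diag {X Y} : L2_rv2 X -> L2_rv2 Y ->
  measurable_fun setT (fun t => cov_kernel P X Y t t).
Proof.
move=> X2 Y2; rewrite /cov_kernel covariance.unlock expectation.unlock.
have [mX _] := pointwise_mean_Hmean X2; have [mY _] := pointwise_mean_Hmean Y2.
have /Lfun1_integrable :=
  Lfun2_mul_Lfun1 (centered_joint X2 mX) (centered_joint Y2 mY).
by rewrite /pointwise_mean expectation.unlock => /measurable_fubini_G.
Qed.

Lemma trace_covE {X Y} : L2_rv2 X -> L2_rv2 Y ->
  trace_cov P X Y = fine (\int[leb01 R]_t cov_kernel P X Y t t)%E.
Proof.
move=> X2 Y2; have [hX _] := HmeanP X2; have [hY _] := HmeanP Y2.
have jX := centered_joint X2 hX; have jY := centered_joint Y2 hY.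
rewrite /trace_cov expectation_inner//.
- congr fine; apply: ae_eq_integral => //.
  + rewrite unlock; have /Lfun1_integrable := Lfun2_mul_Lfun1 jX jY.
    exact: measurable_fubini_G.
  + exact: measurable_cov_kernel_diag.
  (* The two integrands differ only in their centrings, which agree almost everywhere. *)
  have := Hmean_ae X2; have := Hmean_ae Y2.
  apply: (@filterS2 _ _ (ae_filter_ringOfSetsType (leb01 R))) => t /= /(_ I) Yt /(_ I) Xt _.
  by rewrite /cov_kernel /Hcentered Xt Yt covariance.unlock.
- by move=> w; apply: Lfun2B => //; case: X2 => -[].
- by move=> w; apply: Lfun2B => //; case: Y2 => -[].
Qed.

End L2_random_variables.

Lemma leb01_ae01 (R : realType) : {ae leb01 R, forall t, 0 <= t <= 1}.
Proof.
exists (~` `[0, 1]); split.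
- exact: measurableC.
- by rewrite /leb01 /= /mfrestr /mrestr setICl measure0.
- by move=> t /=; rewrite in_itv.
Qed.

(** * The trace-covariogram in terms of the diagonal of [sigma] *)

Section trace_covariogram.
Context {R : realType} {dO} {Omega : measurableType dO} {d : nat}.
Context {P : probability Omega R} {chi : 'rV[R]_d -> Omega -> R -> R}.
Context {sigma : R -> R -> R -> R}.
Hypotheses (chi2 : forall s, L2_rv2 P (chi s)).
Hypothesis chi_sigma : isotropic_kernel P chi sigma.

(** The pair behind the value chosen by [xget] may differ from [s1], [s2]; this is harmless, since
    [sigma] sees only the distance. *)
Lemma trace_covariogramP (s1 s2 : 'rV[R]_d) : exists r1 r2 : 'rV[R]_d,
  enorm (r1 - r2) = enorm (s1 - s2) /\
  trace_covariogram P chi (enorm (s1 - s2)) = trace_cov P (chi r1) (chi r2).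
Proof.
pose T := [set c | exists r1 r2 : 'rV[R]_d, enorm (r1 - r2) = enorm (s1 - s2) /\
  c = trace_cov P (chi r1) (chi r2)].
have : exists c, T c by exists (trace_cov P (chi s1) (chi s2)), s1, s2.
by move=> /(xgetPex 0).
Qed.

Lemma trace_covariogram_eq0 (s1 s2 : 'rV[R]_d) :
  (forall t, 0 <= t <= 1 -> sigma (enorm (s1 - s2)) t t = 0) ->
  trace_covariogram P chi (enorm (s1 - s2)) = 0.
Proof.
move=> s0; have [r1 [r2 [r12 ->]]] := trace_covariogramP s1 s2.
rewrite trace_covE// (_ : integral _ _ _ = 0%E)//.
rewrite -(integral0 (leb01 R) setT); apply: ae_eq_integral => //.
  exact: measurable_cov_kernel_diag.
have [_] := chi_sigma r1 r2; have := leb01_ae01 R.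
apply: (@filterS2 _ _ (ae_filter_ringOfSetsType (leb01 R))) => t t01 -> _.
by rewrite r12 s0.
Qed.

(** By [trace_covE] both sides integrate kernel diagonals, which agree almost everywhere with
    [sigma] at the two distances. *)
Lemma trace_covariogram_eq (s1 s2 s1' s2' : 'rV[R]_d) :
  (forall t, 0 <= t <= 1 ->
    sigma (enorm (s1 - s2)) t t = sigma (enorm (s1' - s2')) t t) ->
  trace_covariogram P chi (enorm (s1 - s2)) =
  trace_covariogram P chi (enorm (s1' - s2')).
Proof.
move=> ss; have [r1 [r2 [r12 ->]]] := trace_covariogramP s1 s2.
have [r1' [r2' [r12' ->]]] := trace_covariogramP s1' s2'.
rewrite !trace_covE//; congr fine; apply: ae_eq_integral => //;
  [exact: measurable_cov_kernel_diag..|].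
have [_] := chi_sigma r1 r2; have [_] := chi_sigma r1' r2'.
have := leb01_ae01 R.
apply: (@filterS3 _ _ (ae_filter_ringOfSetsType (leb01 R))) => t t01 -> -> _.
by rewrite r12 r12' ss.
Qed.

End trace_covariogram.

(** * Evaluation of the effective sample size *)

Theorem proposition3p2 (R : realType) (d n : nat) (hn : (1 <= n)%N)
  (dO : measure_display) (Omega : measurableType dO) (P : probability Omega R)
  (chi : 'rV[R]_d -> Omega -> R -> R)
  (hchi : functional_random_field chi)
  (hiso : isotropic P chi)
  (sigma : R -> R -> R -> R)
  (hsigma : isotropic_kernel P chi sigma)
  (hpos : 0 < trace_covariogram P chi 0)
  (s : 'I_n -> 'rV[R]_d) :
  ((forall t : R, 0 <= t <= 1 ->
      forall i j : 'I_n, i != j -> sigma (enorm (s i - s j)) t t = 0) ->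
   ESS_F P chi s = n%:R) /\
  ((forall t : R, 0 <= t <= 1 ->
      forall i j : 'I_n, sigma (enorm (s i - s j)) t t = sigma 0 t t) ->
   ESS_F P chi s = 1).
Proof.
have chi2 r : L2_rv2 P (chi r) by split=> //; case: hiso => -[].
have enormD (r : 'rV[R]_d) : enorm (r - r) = 0.
  rewrite subrr /enorm big1 ?sqrtr0// => k _.
  by rewrite mxE expr0n.
have tr0 := lt0r_neq0 hpos.
have n0 : n%:R != 0 :> R by rewrite pnatr_eq0 -lt0n.
split=> hs; rewrite /ESS_F.
(* Each row keeps only its diagonal term, so the double sum is [n] times the value at 0. *)
- under eq_bigr => i _.
    rewrite (bigD1 i)//= enormD big1 ?addr0; last first.
      move=> j ji; apply: (trace_covariogram_eq0 chi2 hsigma) => t t01.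
      by rewrite hs// eq_sym.
    over.
  rewrite sumr_const card_ord -[X in X^-1]mulr_natl expr2 -(mulrA n%:R n%:R).
  by rewrite mulfK// mulf_neq0.
(* All [n ^ 2] terms equal the value at 0. *)
- under eq_bigr => i _.
    under eq_bigr => j _.
      rewrite (_ : trace_covariogram _ _ _ = trace_covariogram P chi 0); last first.
        (* Distance 0 is written as that of the origin to itself, to fit [trace_covariogram_eq]. *)
        rewrite -[in RHS](enormD 0).
        apply: (trace_covariogram_eq chi2 hsigma) => t t01.
        by rewrite hs// enormD.
      over.
    over.
  rewrite !sumr_const !card_ord -mulrnA -[X in X^-1]mulr_natl natrM -expr2.
  by rewrite divff// mulf_neq0// expf_neq0.
Qed.
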